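(* For every finite non-cyclic group $G$, $$\frac{\mathfrak{md}_{\mathbb{Q}}(G)}{\#G}\leq \frac{3}{2}.$$
   Context: All $G$-sets are finite left $G$-sets. For a commutative ring $k$ and a $G$-set $X$, $k[X]$ denotes the permutation module of maps $X\to k$, a module over the group algebra $kG$. Two $G$-sets $X,Y$ are linearly equivalent over $k$ if $k[X]\cong k[Y]$ as $kG$-modules. $\mathfrak{md}_k(G)$ is the smallest integer $n$ such that there exist non-isomorphic $G$-sets $X,Y$ with $\#X=\#Y=n$ that are linearly equivalent over $k$; if no such pair exists, $\mathfrak{md}_k(G)=\infty$. *)

(* Defs.v *)
From HB Require Import structures.
From mathcomp Require Import all_boot all_order all_algebra all_fingroup all_solvable.
From mathcomp Require Import boolp constructive_ereal.

Set Implicit Arguments.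
Unset Strict Implicit.
Unset Printing Implicit Defensive.

Import GRing.Theory.
Local Open Scope ring_scope.

(* MathComp's [action] is a right action, hence a separate record for left
   G-sets; the group G is the whole type [gT]. *)
Record gset (gT : finGroupType) := GSet {
  gset_sort :> finType;
  gact : gT -> gset_sort -> gset_sort;
  gact1 : forall x, gact 1%g x = x;
  gactM : forall g h x, gact (g * h)%g x = gact g (gact h x) }.

Definition gset_iso (gT : finGroupType) (X Y : gset gT) : Prop :=
  exists2 phi : X -> Y, bijective phi & forall g x, phi (gact g x) = gact g (phi x).

(* The group algebra kG: the function [a] stands for \sum_g a(g) g. *)
Definition galg (k : comPzRingType) (gT : finGroupType) : Type := {ffun gT -> k}.

(* The permutation module k[X] of all maps X -> k. *)
Definition permmod (k : comPzRingType) (gT : finGroupType) (X : gset gT) : Type :=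
  {ffun X -> k}.

HB.instance Definition _ (k : comPzRingType) (gT : finGroupType) :=
  GRing.Zmodule.copy (galg k gT) {ffun gT -> k}.
HB.instance Definition _ (k : comPzRingType) (gT : finGroupType) (X : gset gT) :=
  GRing.Zmodule.copy (permmod k X) {ffun X -> k}.

Section PermutationModule.
Variables (k : comPzRingType) (gT : finGroupType).
Implicit Types a b c : galg k gT.

Definition galg_one : galg k gT := [ffun g => (g == 1%g)%:R].

Definition galg_mul a b : galg k gT :=
  [ffun g => \sum_(h : gT) a h * b (h^-1 * g)%g].

(* A group element g acts on maps by (g f)(x) = f (g^-1 x). *)
Definition permmod_scale (X : gset gT) a (f : permmod k X) : permmod k X :=
  [ffun x => \sum_(g : gT) a g * f (gact g^-1%g x)].

Lemma permmod_scaleA (X : gset gT) a b (f : permmod k X) :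
  permmod_scale a (permmod_scale b f) = permmod_scale (galg_mul a b) f.
Proof.
apply/ffunP=> x; rewrite !ffunE.
under [RHS]eq_bigr do rewrite ffunE mulr_suml.
rewrite exchange_big; apply: eq_bigr => g _ /=.
rewrite ffunE mulr_sumr (reindex_inj (mulgI g^-1%g)) /=.
by apply: eq_bigr => h _; rewrite mulrA -gactM invMg invgK mulgK.
Qed.

Lemma permmod_scale1 (X : gset gT) : left_id galg_one (@permmod_scale X).
Proof.
move=> f; apply/ffunP=> x; rewrite !ffunE (bigD1 1%g) //= big1 => [|g /negPf g1].
  by rewrite ffunE eqxx mul1r invg1 gact1 addr0.
by rewrite ffunE g1 mul0r.
Qed.

Lemma permmod_scaleDr (X : gset gT) : right_distributive (@permmod_scale X) +%R.
Proof.
move=> a f1 f2; apply/ffunP=> x; rewrite !ffunE -big_split.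
by apply: eq_bigr => g _; rewrite ffunE mulrDr.
Qed.

Lemma permmod_scaleDl (X : gset gT) (f : permmod k X) :
  {morph (@permmod_scale X)^~ f : a b / a + b}.
Proof.
move=> a b; apply/ffunP=> x; rewrite !ffunE -big_split.
by apply: eq_bigr => g _; rewrite ffunE mulrDl.
Qed.

Lemma galg_mulA : associative galg_mul.
Proof.
move=> a b c; exact: (@permmod_scaleA (GSet (@mul1g gT) (fun g h x => esym (mulgA g h x)))).
Qed.

Lemma galg_mul1r : left_id galg_one galg_mul.
Proof.
exact: (@permmod_scale1 (GSet (@mul1g gT) (fun g h x => esym (mulgA g h x)))).
Qed.

Lemma galg_mulr1 : right_id galg_one galg_mul.
Proof.
move=> a; apply/ffunP=> g; rewrite !ffunE (bigD1 g) //= big1 => [|h /negPf hg].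
  by rewrite ffunE mulVg eqxx mulr1 addr0.
by rewrite ffunE -eq_mulVg1 hg mulr0.
Qed.

Lemma galg_mulDl : left_distributive galg_mul +%R.
Proof.
move=> a b c; apply/ffunP=> x; rewrite !ffunE -big_split.
by apply: eq_bigr => g _; rewrite ffunE mulrDl.
Qed.

Lemma galg_mulDr : right_distributive galg_mul +%R.
Proof.
move=> a b c; apply/ffunP=> x; rewrite !ffunE -big_split.
by apply: eq_bigr => g _; rewrite ffunE mulrDr.
Qed.

HB.instance Definition _ := GRing.Zmodule_isPzRing.Build (galg k gT)
  galg_mulA galg_mul1r galg_mulr1 galg_mulDl galg_mulDr.

HB.instance Definition _ (X : gset gT) :=
  GRing.Zmodule_isLmodule.Build (galg k gT) (permmod k X)
    (@permmod_scaleA X) (@permmod_scale1 X) (@permmod_scaleDr X)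
    (@permmod_scaleDl X).

End PermutationModule.

(* [{linear _ -> _}] is over the group algebra [galg k gT]. *)
Definition linearly_equivalent (k : comPzRingType) (gT : finGroupType)
    (X Y : gset gT) : Prop :=
  exists phi : {linear permmod k X -> permmod k Y}, bijective phi.

Definition md_witness (k : comPzRingType) (gT : finGroupType) (n : nat) : Prop :=
  exists X Y : gset gT,
    [/\ #|X| = n, #|Y| = n, ~ gset_iso X Y & linearly_equivalent k X Y].

(* Extended-rational valued, so that the quotient by the group order makes
   sense also when there is no witness. *)
Definition md (k : comPzRingType) (gT : finGroupType) : \bar rat :=
  if pselect (exists n, `[< md_witness k gT n >]) is left ex
  then (ex_minn ex)%:R%:E else +oo%E.

(* Main.v *)
From HB Require Import structures.
Require Import Defs.
From mathcomp Require Import all_boot all_order all_algebra all_fingroup all_solvable.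
From mathcomp Require Import all_field.
From mathcomp Require Import boolp constructive_ereal.

(* A non-cyclic group has a section H/K that is non-cyclic of order pq, p and q
   primes, with a normal subgroup <x> of order p: a non-cyclic section of least
   order has all proper subgroups and quotients cyclic. If y lies outside <x>,
   every y x^j has order q, and
     H/K + q (H/H)  and  H/<x>K + \sum_(j < q) H/<y x^j>K
   are linearly equivalent over Q; after induction to G only the former has a
   point with stabilizer of order |K|. Both sets induce to G-sets with
   |G : K| (1 + 1/p) <= 3/2 |G| points.
   The isomorphism sums functions along cosets. It is injective: if
   (y x^j)^i = x^(j t_i) y^i, the t_i (i < q) are distinct mod p, so at each p-th
   root of unity the Fourier transforms along <x> of a function in the kernel
   satisfy a Vandermonde system. *)

Set Implicit Arguments.
Unset Strict Implicit.
Unset Printing Implicit Defensive.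

Import Order.TTheory GRing.Theory Num.Theory.

(** * Minimal non-cyclic groups *)

Section MinimalNonCyclic.
Local Open Scope group_scope.
Variables (rT : finGroupType) (F : {group rT}).
Hypothesis ncF : ~~ cyclic F.
Hypothesis properF : forall A : {group rT}, A \proper F -> cyclic A.

(** Both subgroups are abelian and together generate [F], so a common element commutes with all of
    [F]. *)
Lemma maximal_cyclic_TI (M1 M2 : {group rT}) : 'Z(F) = 1 ->
  maximal M1 F -> maximal M2 F -> M1 :!=: M2 -> M1 :&: M2 = 1.
Proof.
move=> ZF maxM1 maxM2 neM.
have [/maxgroupp prM1 /maxgroupp prM2] := (maxM1, maxM2).
have [sM1 sM2] := (proper_sub prM1, proper_sub prM2).
have abM (M : {group rT}) : M \proper F -> abelian M by move/properF/cyclic_abelian.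
have defF : M1 <*> M2 = F.
  have sJ: M1 <*> M2 \subset F by rewrite join_subG sM1.
  apply/eqP; rewrite eqEproper sJ; apply/negP => prJ.
  case/maxgroupP: maxM1 => _ /(_ _ prJ (joing_subl _ _)) eJ1.
  case/maxgroupP: maxM2 => _ /(_ _ prJ (joing_subr _ _)) eJ2.
  by case/eqP: neM; rewrite -eJ1.
apply/trivgP; rewrite -ZF subsetI subIset ?sM1 //=.
rewrite -defF centY subsetI; apply/andP; split.
  by apply: subset_trans (subsetIl _ _) (abM _ prM1).
by apply: subset_trans (subsetIr _ _) (abM _ prM2).
Qed.

(* In a simple group with trivial centre whose maximal subgroups are cyclic,
   the conjugates of a maximal subgroup M cover |F| - |F : M| >= |F| / 2
   nontrivial elements, and non-conjugate ones cover disjoint sets. *)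
Lemma minimal_noncyclic_not_simple : ~~ simple F.
Proof.
apply/negP => simF; have [ntF nF] := simpleP _ simF.
have ZF : 'Z(F) = 1.
  case: (nF _ (center_normal F)) => // ZF.
  have abF : abelian F by apply/center_idP.
  case/negP: ncF; apply: prime_cyclic.
  exact: simple_sol_prime (abelian_sol abF) simF.
have mem_max x : x \in F -> exists2 M : {group rT}, maximal M F & x \in M.
  move=> Fx; have sxF : <[x]> \subset F by rewrite cycle_subG.
  case: (maximal_exists sxF) => [eF | [M maxM sM]].
    by case/negP: ncF; rewrite -eF cycle_cyclic.
  by exists M => //; rewrite -cycle_subG.
have card_supp (M : {group rT}) : maximal M F -> M :!=: 1 ->
   (#|class_support M^# F| + #|F : M| = #|F|)%N.
  move=> maxM ntM; have prM := maxgroupp maxM; have sM := proper_sub prM.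
  (* By maximality [M] is its own normalizer, since simplicity of [F] keeps [M] from being normal.
     Hence a conjugate by an element outside [M] differs from [M] and meets it trivially. *)
  have TI : normedTI M^# F M.
    apply/normedTI_memJ_P; split=> [|//|a g].
      by rewrite setD_eq0 subG1.
    rewrite !inE => /andP[nt_a Ma] Fg; rewrite conjg_eq1 nt_a /=.
    apply/idP/idP=> [Mag | Mg]; last by rewrite groupJ.
    have nMF : 'N_F(M) = M.
      apply/eqP; rewrite eqEsubset andbC subsetI sM normG /=.
      have /maxgroupP[_ /(_ 'N_F(M)%G)] := maxM.
      case: (boolP ('N_F(M) \proper F)) => [prN -> //|].
        by rewrite subsetI sM normG.
      rewrite properE subsetIl negbK subsetI subxx /= => nM.
      case: (nF M) => [| M1 | MF]; first by rewrite /normal sM.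
        by rewrite M1 eqxx in ntM.
      by move: prM; rewrite MF properxx.
    have maxMg : maximal (M :^ g^-1)%G F.
      by rewrite -(conjGid (groupVr Fg)) maximalJ.
    case: (eqVneq (M :^ g^-1) M) => [eM | neM].
      by rewrite -nMF -groupV !inE groupV Fg eM subxx.
    have := maximal_cyclic_TI ZF maxMg maxM neM.
    move/setP/(_ a); rewrite !inE Ma mem_conjg invgK Mag (negPf nt_a) => //.
  rewrite (card_support_normedTI TI) -(Lagrange sM) (cardsD1 1 M) group1 /=.
  by rewrite mulnDl mul1n addnC.
have [x Fx nt_x] := trivgPn _ ntF.
have [M maxM Mx] := mem_max x Fx.
have ntM : M :!=: 1 by apply/trivgPn; exists x.
have cM := card_supp M maxM ntM.
have half (N : {group rT}) : maximal N F -> N :!=: 1 -> (#|F : N|.*2 <= #|F|)%N.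
  move=> /maxgroupp/proper_sub sN ntN; rewrite -(Lagrange sN) -muln2 mulnC leq_mul2r.
  by rewrite cardG_gt1 ntN orbT.
have indM : (1 < #|F : M|)%N by rewrite indexg_gt1; case/andP: (maxgroupp maxM).
have sCF (N : {group rT}) : maximal N F -> class_support N^# F \subset F^#.
  move=> /maxgroupp/proper_sub sN; apply/subsetP=> z /imset2P[a g].
  by case/setD1P=> nta Na Fg ->; rewrite !inE conjg_eq1 nta groupJ ?(subsetP sN a Na).
have cF1 : (#|F^#|.+1 = #|F|)%N by rewrite (cardsD1 1 F) group1.
(* The conjugates of [M^#] miss [#|F : M|] > 1 elements of [F], hence some element besides 1. *)
have /subsetPn[z F1z nz] : ~~ (F^# \subset class_support M^# F).
  apply/negP=> /subset_leq_card; rewrite -ltnS cF1 -cM -addn1 leq_add2l.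
  by rewrite leqNgt indM.
have [nt_z Fz] := setD1P F1z.
have [N maxN Nz] := mem_max z Fz.
have ntN : N :!=: 1 by apply/trivgPn; exists z.
have cN := card_supp N maxN ntN.
have dis : [disjoint class_support M^# F & class_support N^# F].
  apply/pred0P => u /=; apply/negP => /andP[/imset2P[a g M1a Fg ->]].
  case/imset2P=> b h N1b Fh eab.
  have [[nta Ma] [ntb Nb]] := (setD1P M1a, setD1P N1b).
  have maxMg : maximal (M :^ (g * h^-1))%G F.
    by rewrite -(conjGid (groupM Fg (groupVr Fh))) maximalJ.
  case: (eqVneq (M :^ (g * h^-1)) N) => [eM | neM].
    case/negP: nz; apply/imset2P; exists (z ^ (g * h^-1)^-1) (g * h^-1).
    - by rewrite !inE conjg_eq1 nt_z -mem_conjg eM.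
    - by rewrite groupM ?groupV.
    - by rewrite conjgKV.
  move/setP/(_ b): (maximal_cyclic_TI ZF maxMg maxN neM).
  rewrite !inE Nb (negPf ntb) mem_conjg.
  suff -> : b ^ (g * h^-1)^-1 = a by rewrite Ma.
  by rewrite invMg invgK conjgM -eab conjgK.
have sum_le : (#|class_support M^# F| + #|class_support N^# F| < #|F|)%N.
  rewrite -cF1 ltnS -cardsUI disjoint_setI0 // cards0 addn0.
  by apply: subset_leq_card; rewrite subUset !sCF.
have ind_le : (#|F : M| + #|F : N| <= #|F|)%N.
  by rewrite -leq_double doubleD -[leqRHS]addnn leq_add ?half.
(* The two supports and the two indices add up to exactly 2|F|, whereas these bounds make the total
   smaller. *)
by have := leq_add sum_le ind_le; rewrite addSn addnACA cM cN ltnn.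
Qed.

Hypothesis quotientF :
  forall N : {group rT}, N <| F -> N :!=: 1 -> cyclic (F / N).

Lemma minimal_noncyclic_abelian : 'Z(F) != 1 -> abelian F.
Proof.
by move/(quotientF (center_normal F))/cyclic_center_factor_abelian.
Qed.

(** A proper nontrivial normal subgroup is cyclic, so its subgroups of prime order are
    characteristic in it and therefore normal in [F]. *)
Lemma minimal_noncyclic_normal_prime :
  exists2 x, x \in F & <[x]> <| F /\ prime #[x].
Proof.
have ntF : F :!=: 1 by apply: contraNneq ncF => ->; apply: cyclic1.
have [N [nNF ntN prN]] : exists N : {group rT}, [/\ N <| F, N :!=: 1 & N \proper F].
  have := minimal_noncyclic_not_simple; rewrite simple_maxnormal.
  move=> nsF; have : ~~ [forall N : {group rT}, (N <| F) ==> (N :==: 1) || (N :==: F)].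
    apply: contra minimal_noncyclic_not_simple => /forallP nF.
    apply/simpleP; split=> // H nH.
    by have /implyP/(_ nH)/orP[/eqP|/eqP] := nF H; [left | right].
  case/forallPn=> N; rewrite negb_imply negb_or => /and3P[nNF ntN neN].
  by exists N; rewrite properEneq neN normal_sub.
have cycN := properF prN.
have pr_p := pdiv_prime (etrans (cardG_gt1 N) ntN).
have [x Nx ox] := Cauchy pr_p (pdiv_dvd #|N|).
exists x; first exact: (subsetP (normal_sub nNF)).
rewrite ox; split=> //; apply: char_normal_trans nNF.
by rewrite sub_cyclic_char // cycle_subG.
Qed.

(** Here [F] is a semidirect product of [P] = <x> and a cyclic <y>. For a suitable z of prime order
    in <y>, the subgroup P<z> cannot be cyclic, so it is all of [F]. *)
Lemma minimal_noncyclic_metacyclic :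
  exists2 x, x \in F & [/\ <[x]> <| F, prime #[x] & prime #|F : <[x]>|].
Proof.
have [x Fx [nxF pr_x]] := minimal_noncyclic_normal_prime.
exists x => //; split=> //; set P := <[x]> in nxF *.
have [sPF nPF] := andP nxF.
have ntP : P != 1 by rewrite -cardG_gt1 prime_gt1.
have /cyclicP[yb defQ] := quotientF nxF ntP.
have /morphimP[y Ny Fy def_yb] : yb \in F / P by rewrite defQ cycle_id.
have defF : P * <[y]> = F.
  apply/eqP; rewrite eqEsubset mul_subG ?cycle_subG //=.
  rewrite -quotientSK // -?quotient_cycle // ?defQ def_yb //.
  by rewrite -quotient_cycle.
have TI : P :&: <[y]> = 1.
  rewrite prime_TIg //; apply: contra ncF => sPy.
  by rewrite -defF (mulSGid sPy) cycle_cyclic.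
have cardF : #|F| = (#[x] * #[y])%N by rewrite -defF TI_cardMg.
have iF : #|F : P| = #[y].
  by apply/eqP; rewrite -(eqn_pmul2l (cardG_gt0 P)) (Lagrange sPF) cardF.
have y_gt1 : (1 < #[y])%N.
  rewrite -iF indexg_gt1; apply: contra ncF => sFP.
  by apply: cyclicS sFP (cycle_cyclic x).
(* If #[x] divides #[y], a cyclic P<z> would contain two distinct subgroups of order #[x]. Otherwise
   a cyclic P<z> makes z central, so [F] is abelian, and cyclic as a product of cyclic groups of
   coprime orders. *)
pose q := if #[x] %| #[y] then #[x] else pdiv #[y].
have pr_q : prime q by rewrite /q; case: ifP => _ //; apply: pdiv_prime.
have q_dv : q %| #[y] by rewrite /q; case: ifP => // _; apply: pdiv_dvd.
pose z := y ^+ (#[y] %/ q).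
have oz : #[z] = q by rewrite orderXdiv ?dvdn_div // divnA ?mulKn.
have szy : <[z]> \subset <[y]> by rewrite cycleX.
have nzP : <[z]> \subset 'N(P) by rewrite cycle_subG groupX.
have TIz : P :&: <[z]> = 1 by apply/trivgP; rewrite -TI setIS.
have cardA : #|P <*> <[z]>| = (#[x] * q)%N by rewrite norm_joinEr // TI_cardMg // -!orderE oz.
have sAF : P <*> <[z]> \subset F.
  by rewrite join_subG sPF (subset_trans szy) // cycle_subG.
have [eA | neA] := eqVneq (P <*> <[z]>) F.
  rewrite iF; have := cardF; rewrite -eA cardA => /eqP.
  by rewrite eqn_pmul2l ?order_gt0 // => /eqP <-.
have cycA : cyclic (P <*> <[z]>) by apply: (properF (A := _ <*> _)%G); rewrite properEneq neA.
case/negP: ncF; have [dv | ndv] := boolP (#[x] %| #[y]).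
  have : P == <[z]>.
    rewrite (eq_subG_cyclic cycA) ?joing_subl ?joing_subr //.
    by rewrite -!orderE oz /q dv.
  by move/eqP=> eP; move: ntP; rewrite -TIz -eP setIid eqxx.
have abF : abelian F.
  apply: minimal_noncyclic_abelian; apply/trivgPn; exists z.
    rewrite inE groupX //= -cycle_subG centsC.
    rewrite -defF mul_subG //.
      by apply: (sub_abelian_cent2 (cyclic_abelian cycA)); rewrite ?joing_subl ?joing_subr.
    exact: (sub_abelian_cent2 (cycle_abelian y)).
  by rewrite -cycle_eq1 -cardG_gt1 -orderE oz prime_gt1.
rewrite -defF; apply: cyclicM; rewrite ?cycle_cyclic //.
  by apply: sub_abelian_cent2 abF _ _; rewrite cycle_subG.
by rewrite -!orderE prime_coprime.
Qed.

End MinimalNonCyclic.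

(** * Non-cyclic sections of least order *)

Section MetacyclicSection.
Local Open Scope group_scope.

Lemma noncyclic_metacyclic_section (gT : finGroupType) (G : {group gT}) : ~~ cyclic G ->
  exists H K : {group gT}, [/\ K <| H, ~~ cyclic (H / K) &
    exists2 x, x \in (H / K)%g &
      [/\ (<[x]> <| H / K)%g, prime #[x] & prime #|(H / K)%g : <[x]>|]].
Proof.
move=> ncG.
pose S (s : {group gT} * {group gT}) := (s.2 <| s.1) && ~~ cyclic (s.1 / s.2).
have S0 : S (G, 1%G).
  by rewrite /S /= normal1 -(isog_cyclic (quotient1_isog G)).
have [[H K] /andP[/= nKH ncHK] minHK] :=
  arg_minnP (fun s : {group gT} * {group gT} => #|s.1 : s.2|) S0.
exists H, K; split=> //.
have [sKH nK] := andP nKH.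
apply: minimal_noncyclic_metacyclic (H / K)%G ncHK _ _ => [A prA | N nN ntN].
  have [A' defA' sKA' sA'H] := inv_quotientS nKH (proper_sub prA).
  have := proper_card prA; apply: contraLR => ncA; rewrite -leqNgt.
  have nKA' : K <| A' by apply: normalS nKH.
  have := minHK (A', K); rewrite /S /= nKA' -defA' ncA => /(_ isT).
  rewrite -!card_quotient ?(normal_norm nKA') //.
  by rewrite -defA'.
have [N' defN' sKN' nN'] := inv_quotientN nKH nN.
rewrite defN' (isog_cyclic (third_isog sKN' nKH nN')).
apply: contraNT ntN => ncN; have := minHK (H, N'); rewrite /S /= nN' ncN => /(_ isT).
rewrite -[leqLHS](Lagrange_index (normal_sub nN') sKN') -[leqRHS]muln1 => le.
have sN'K : N' \subset K.
  by rewrite -indexg_eq1 eqn_leq indexg_gt0 andbT -(leq_pmul2l (indexg_gt0 H N')).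
by rewrite defN' -subG1 quotient_sub1 // (subset_trans sN'K) ?normG.
Qed.

End MetacyclicSection.

(** * Sums over the cosets of cyclic subgroups *)

Local Open Scope ring_scope.

Lemma power_sums_eq0 (K : fieldType) n (a v : 'I_n -> K) : injective a ->
  (forall j : 'I_n, \sum_i a i ^+ j * v i = 0) -> forall i, v i = 0.
Proof.
move=> inj_a eq0 i; pose A := Vandermonde n (\row_i a i).
have uA : A \in unitmx.
  rewrite unitmxE det_Vandermonde unitfE; apply/prodf_neq0 => k _.
  apply/prodf_neq0 => l lt_kl; rewrite !mxE subr_eq0.
  by apply: contraTneq lt_kl => /inj_a ->; rewrite ltnn.
have : A *m \col_i v i = 0.
  apply/colP=> j; rewrite !mxE -[RHS](eq0 j).
  by apply: eq_bigr => k _; rewrite !mxE.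
by move/(canRL (mulKmx uA))/colP/(_ i); rewrite mulmx0 !mxE.
Qed.

Lemma sum_cycle (rT : finGroupType) (V : nmodType) (z : rT) (h : rT -> V) :
  \sum_(u in <[z]>%g) h u = \sum_(i < #[z]%g) h (z ^+ i)%g.
Proof.
pose s := traject (mulg z) 1%g #[z]%g.
have us : uniq s.
  by apply/card_uniqP; rewrite size_traject -(eq_card (cycle_traject z)).
rewrite (eq_bigl _ _ (cycle_traject z)) -(big_uniq _ us) (big_nth 1%g) size_traject.
rewrite big_mkord; apply: eq_bigr => i _; congr h; rewrite nth_traject //.
by elim: (i : nat) => //= n ->; rewrite expgS.
Qed.

Lemma sum_shift_periodic (V : zmodType) (p : nat) (g : nat -> V) n :
  (forall a, g (a + p)%N = g a) -> \sum_(a < p) g (a + n)%N = \sum_(a < p) g a.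
Proof.
move=> per; elim: n => [|n IHn]; first by under eq_bigr do rewrite addn0.
rewrite -{}IHn; under eq_bigr do rewrite addnS -addSn.
case: p per => [|p] per; first by rewrite !big_ord0.
rewrite big_ord_recr [RHS]big_ord_recl addrC; congr (_ + _).
by rewrite add0n -(per n) addnC.
Qed.

Section SectionSums.
Variables (rT : finGroupType) (x y : rT) (q : nat).
Hypotheses (pr_x : prime #[x]%g) (pr_q : prime q).
Hypotheses (nxy : (y \in 'N(<[x]>))%g) (oyx : forall j, #[y * x ^+ j]%g = q).

(** If y x y^-1 = x^s, then t_i = s + ... + s^i. An equality t_i = t_k with k < i gives (y x)^m =
    y^m for m = i - k < q; as y x and y have prime order q, this forces y x = y. *)
Lemma expg_translates : exists2 t : nat -> nat,
   forall i j, ((y * x ^+ j) ^+ i = x ^+ (j * t i) * y ^+ i)%g &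
   {in gtn q &, forall i k, t i = t k %[mod #[x]%g] -> i = k}.
Proof.
have /cycleP[s def_s] : (x ^ y^-1 \in <[x]>)%g by rewrite memJ_norm ?groupV // cycle_id.
have xy i j : (y ^+ i * x ^+ j = x ^+ (j * s ^ i) * y ^+ i)%g.
  have y1 k : (y * x ^+ k = x ^+ (k * s) * y)%g.
    rewrite mulnC expgM -def_s -conjXg /conjg invgK -!mulgA; congr (_ * _)%g.
    by rewrite mulVg mulg1.
  elim: i j => [|i IHi] j; first by rewrite !expg0 mul1g mulg1 muln1.
  by rewrite expgS -mulgA IHi mulgA y1 -mulgA -mulnA -expnSr.
pose t i := (\sum_(k < i) s ^ k.+1)%N.
have tE i j : ((y * x ^+ j) ^+ i = x ^+ (j * t i) * y ^+ i)%g.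
  elim: i => [|i IHi]; first by rewrite /t big_ord0 muln0 mul1g.
  rewrite expgSr IHi mulgA -[(_ * y)%g]mulgA -expgSr -mulgA xy mulgA -expgD -mulnDr.
  by rewrite /t big_ord_recr.
exists t => //.
have main i k : (k <= i < q)%N -> t i = t k %[mod #[x]%g] -> i = k.
  case/andP=> le_ki lt_iq /eqP; rewrite -eq_expg_mod_order => /eqP eq_t.
  have [m def_m] : {m | i = k + m}%N by exists (i - k)%N; rewrite subnKC.
  have : ((y * x) ^+ m = y ^+ m)%g.
    apply: (@mulgI _ (x ^+ t k * y ^+ k)%g).
    rewrite -{2}eq_t -[RHS]mulgA -expgD -def_m.
    have := tE k 1%N; have := tE i 1%N; rewrite !mul1n expg1 => <- <-.
    by rewrite -expgD def_m.
  case: (posnP m) => [m0 _ | m_gt0 eqm]; first by rewrite def_m m0 addn0.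
  have [oy ox] := (oyx 0%N, oyx 1%N); rewrite expg0 mulg1 expg1 in oy ox.
  have co (w : rT) : #[w]%g = q -> coprime #|<[w]>%g| m.
    rewrite -orderE => ->; rewrite prime_coprime // gtnNdvd //.
    by apply: leq_ltn_trans lt_iq; rewrite def_m leq_addl.
  have := expgK (co _ ox) (cycle_id _).
  rewrite /= eqm /expg_invn -orderE ox -{1}oy orderE.
  rewrite (expgK (co _ oy) (cycle_id _)).
  move/(canLR (mulKg y)); rewrite mulVg => x1.
  by move: pr_x; rewrite -x1 order1.
move=> i k; rewrite !inE => lt_i lt_k; case/orP: (leq_total k i) => le.
  by apply: main; rewrite le.
by move=> /esym/main ->; rewrite ?le.
Qed.

Variables (F : {group rT}) (phi : rT -> algC) (c : nat -> algC).
Hypotheses (Fx : x \in F) (Fy : y \in F).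
Hypothesis sum_x : {in F, forall v, \sum_(u in <[x]>%g) phi (v * u)%g = 0}.
Hypothesis sum_yx : {in F, forall v, forall j, (j < q)%N ->
  \sum_(u in <[y * x ^+ j]>%g) phi (v * u)%g + c j = 0}.

(** Its values at the #[x]-th roots of unity are the Fourier coefficients of a |-> phi (v x^a
    y^i). *)
Let P i v : {poly algC} := \poly_(a < #[x]%g) phi (v * x ^+ a * y ^+ i)%g.

Let P_horner i v (n : nat) (z : algC) : z ^+ #[x]%g = 1 ->
  \sum_(a < #[x]%g) z ^+ a * phi (v * x ^+ (a + n) * y ^+ i)%g
    = z^-1 ^+ n * (P i v).[z].
Proof.
move=> zx; have z0 : z != 0.
  apply: contra_eq_neq zx => ->.
  by rewrite expr0n -[_ == 0%N]negbK -lt0n order_gt0 eq_sym oner_eq0.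
pose g a := z ^+ a * phi (v * x ^+ a * y ^+ i)%g.
have perg a : g (a + #[x]%g)%N = g a.
  by rewrite /g exprD zx mulr1 expgD expg_order mulg1.
rewrite horner_poly.
under [in RHS]eq_bigr do rewrite mulrC -[_ * _]/(g _).
rewrite -(sum_shift_periodic n perg) mulr_sumr; apply: eq_bigr => a _.
by rewrite /g mulrA addnC exprD mulrA -exprMn mulVf // expr1n mul1r.
Qed.

Lemma section_sums_eq0 :
  (forall v, v \in F -> phi v = 0) /\ (forall j, (j < q)%N -> c j = 0).
Proof.
have [t tE t_inj] := expg_translates.
have x_gt0 := order_gt0 x.
(* The hypothesis [sum_yx] at v x^a is weighted by z^a and summed over a; each shift by x^(j t_i)
   becomes a factor z^(-j t_i). *)
have rel v j (z : algC) : v \in F -> (j < q)%N -> z ^+ #[x]%g = 1 ->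
    \sum_(i < q) (z^-1 ^+ t i) ^+ j * (P i v).[z] + c j * \sum_(a < #[x]%g) z ^+ a = 0.
  move=> Fv lt_j zx; rewrite mulr_sumr.
  rewrite (eq_bigr (fun i : 'I_q => \sum_(a < #[x]%g)
    z ^+ a * phi (v * x ^+ (a + j * t i) * y ^+ i)%g)); last first.
    by move=> i _; rewrite P_horner // -exprM mulnC.
  rewrite exchange_big -big_split big1 //= => a _.
  have Fva : (v * x ^+ a)%g \in F by rewrite groupM ?groupX.
  rewrite [c j * _]mulrC -mulr_sumr -mulrDr.
  apply/eqP; rewrite mulf_eq0; apply/orP; right; apply/eqP.
  rewrite -[RHS](sum_yx Fva lt_j) sum_cycle oyx; congr (_ + _).
  by apply: eq_bigr => i _; rewrite tE expgD !mulgA.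
(* As y normalizes <x>, the value at 1 is the sum of [phi] over the coset v y^i <x>. *)
have P1 v i : v \in F -> (P i v).[1] = 0.
  move=> Fv; rewrite horner_poly -[RHS](sum_x (x := v * y ^+ i)%g) ?groupM ?groupX //.
  under eq_bigr do rewrite expr1n mulr1.
  rewrite -(sum_cycle x (fun u => phi (v * u * y ^+ i)%g)).
  rewrite [RHS](reindex_inj (conjg_inj (y ^+ i)%g)) /=.
  apply: eq_big => u; first by rewrite memJ_norm ?groupX.
  by rewrite /conjg !mulgA mulgK.
have c0 j : (j < q)%N -> c j = 0.
  move=> lt_j; have := rel 1%g j 1 (group1 F) lt_j (expr1n _ _).
  rewrite big1 ?add0r => [|i _]; last by rewrite P1 ?mulr0.
  under eq_bigr do rewrite expr1n.
  rewrite sumr_const card_ord => /eqP; rewrite mulf_eq0 pnatr_eq0 -[_ == 0%N]negbK -lt0n.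
  by rewrite x_gt0 orbF => /eqP.
split=> // v Fv.
have [z prim_z] := C_prim_root_exists x_gt0.
have P0 k i : (k < #[x]%g)%N -> (i < q)%N -> (P i v).[z ^+ k] = 0.
  move=> lt_k lt_i; have zk1 : (z ^+ k) ^+ #[x]%g = 1.
    by rewrite -exprM mulnC exprM (prim_expr_order prim_z) expr1n.
  case: (posnP k) => [-> | k_gt0]; first by rewrite expr0 P1.
  have prim_zk : #[x]%g.-primitive_root (z ^+ k).
    by rewrite prim_root_exp_coprime // coprime_sym prime_coprime // gtnNdvd.
  (* The Vandermonde nodes are distinct because z^k is still primitive, #[x] being prime, and the
     t_i are distinct mod #[x]. *)
  have inj_w : injective (fun i : 'I_q => (z ^+ k)^-1 ^+ t i).
    move=> a b /eqP; rewrite !exprVn (inj_eq invr_inj) (eq_prim_root_expr prim_zk).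
    move/eqP/t_inj => eab.
    by apply/val_inj/eab; rewrite inE ltn_ord.
  apply: (power_sums_eq0 inj_w (v := fun i => (P i v).[z ^+ k]) _ (Ordinal lt_i)) => j.
  by have := rel v j _ Fv (ltn_ord j) zk1; rewrite c0 // mul0r addr0.
(* A polynomial of degree below #[x] vanishing at all #[x]-th roots of unity is zero; its constant
   coefficient is [phi v]. *)
have P00 : P 0%N v = 0.
  apply/eqP/negPn/negP => nzP.
  pose rs := [seq z ^+ (i : nat) | i <- iota 0 #[x]%g].
  suff : (size rs < #[x]%g)%N by rewrite size_map size_iota ltnn.
  apply: leq_trans (size_poly #[x]%g (fun a => phi (v * x ^+ a * y ^+ 0)%g)).
  apply: max_poly_roots nzP _ _.
    apply/allP => u /mapP[k]; rewrite mem_iota => lt_k def_u; rewrite {u}def_u.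
    by apply/rootP/P0; rewrite ?prime_gt0.
  rewrite map_inj_in_uniq ?iota_uniq // => a b; rewrite !mem_iota /= !add0n => lt_a lt_b /eqP.
  by rewrite (eq_prim_root_expr prim_z) !modn_small // => /eqP.
by move/polyP/(_ 0%N): P00; rewrite coef0 coef_poly x_gt0 expg0 !mulg1.
Qed.
End SectionSums.

(** * Unions of coset spaces *)

(** The two spaces have equal dimension. Linearity over [K] is spelled out pointwise because
    [permmod] carries a module structure over the group algebra. *)
Lemma linear_ffun_inj_bij (K : fieldType) (X Y : finType)
    (f : {ffun X -> K} -> {ffun Y -> K}) :
  #|X| = #|Y| ->
  (forall a (u v : {ffun X -> K}),
     f [ffun x => a * u x + v x] = [ffun y => a * f u y + f v y]) ->
  (forall u, f u = [ffun=> 0] -> u = [ffun=> 0]) -> bijective f.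
Proof.
move=> cXY f_lin f_inj.
have lin : linear (f : {ffun X -> K^o} -> {ffun Y -> K^o}).
  move=> a u v; have := f_lin a u v.
  rewrite (_ : [ffun x => a * u x + v x] = (a *: u + v : {ffun X -> K^o})).
    by move=> ->; apply/ffunP => y; rewrite !ffunE.
  by apply/ffunP => x; rewrite !ffunE.
pose mixin := GRing.isLinear.Build _ _ _ _ _ lin.
pose F : {linear {ffun X -> K^o} -> {ffun Y -> K^o}} := HB.pack (f : _ -> _) mixin.
pose h := linfun F.
have hE u : h u = f u by rewrite lfunE.
have z0 (Z : finType) : [ffun=> 0] = 0 :> {ffun Z -> K^o} by apply/ffunP => ?; rewrite !ffunE.
have ker0 : lker h == 0%VS.
  apply/lker0P => u v euv; apply/eqP; rewrite -subr_eq0 -z0; apply/eqP/f_inj.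
  by rewrite -hE linearB /= euv subrr z0.
have img : limg h = fullv.
  apply/eqP; rewrite eqEdim subvf limg_dim_eq ?(eqP ker0) ?capv0 // !dimvf /dim /=.
  by rewrite cXY.
exists (h^-1)%VF => u; rewrite -?hE.
  exact: lker0_lfunK.
by rewrite limg_lfunVK // img memvf.
Qed.

Section CosetSets.
Variables (gT : finGroupType) (I : finType) (L : I -> {group gT}).

(** The disjoint union of the coset spaces G/L_i; the tag in [I] keeps orbits with equal [L i]
    apart. *)
Definition coset_points : finType :=
  {s : I * {set gT} | s.2 \in lcosets (L s.1) [set: gT]}.

Fact coset_act_proof (g : gT) (s : coset_points) :
  (g *: (val s).2)%g \in lcosets (L (val s).1) [set: gT].
Proof.
case: s => -[i A] /= /lcosetsP[h _ ->].
by rewrite -lcosetM; apply/lcosetsP; exists (g * h)%g.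
Qed.

Definition coset_act g s : coset_points :=
  exist _ ((val s).1, g *: (val s).2)%g (coset_act_proof g s).

Fact coset_act1 s : coset_act 1%g s = s.
Proof. by apply: val_inj; case: s => -[i A] /= _; rewrite lcoset1. Qed.

Fact coset_actM g h s : coset_act (g * h)%g s = coset_act g (coset_act h s).
Proof. by apply: val_inj; rewrite /= lcosetM. Qed.

Definition coset_gset : gset gT := GSet coset_act1 coset_actM.

Fact coset_pt_proof i (g : gT) :
  (g *: L i)%g \in lcosets (L i) [set: gT].
Proof. by apply/lcosetsP; exists g. Qed.

Definition coset_pt i g : coset_gset :=
  exist _ (i, (g *: L i)%g) (coset_pt_proof i g).

Lemma coset_ptP (s : coset_gset) : exists i g, s = coset_pt i g.
Proof.
case: s => -[i A] /= sP; have /lcosetsP[g _ /= defA] := sP.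
by exists i, g; apply: val_inj; rewrite /= defA.
Qed.

Lemma coset_act_pt g i h : Defs.gact g (coset_pt i h) = coset_pt i (g * h)%g.
Proof. by apply: val_inj; rewrite /= lcosetM. Qed.

Lemma coset_ptMr i g h : h \in L i -> coset_pt i (g * h)%g = coset_pt i g.
Proof. by move=> Lh; apply: val_inj; rewrite /= lcosetM lcoset_id. Qed.

Lemma coset_stab i g h : Defs.gact h (coset_pt i g) = coset_pt i g -> (h ^ g)%g \in L i.
Proof.
rewrite coset_act_pt => /(congr1 val)[] /= e.
by rewrite conjgE -mem_lcoset -e lcoset_refl.
Qed.

Lemma card_coset_gset : #|coset_gset| = (\sum_i #|[set: gT] : L i|%g)%N.
Proof.
rewrite card_sig -sum1_card.
transitivity (\sum_(i : I) \sum_(A : {set gT} | A \in lcosets (L i) [set: gT]) 1)%N.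
  by rewrite pair_big_dep.
by apply: eq_bigr => i _; rewrite sum1_card card_lcosets.
Qed.

End CosetSets.

(** * Equivariant maps between unions of coset spaces *)

Section CosetMap.
Variables (k : comPzRingType) (gT : finGroupType) (I : finType) (L M : I -> {group gT}).
Variable n : I -> I -> k.

(** The sum runs over group elements of the target coset, with weight matrix [n]; this makes it
    independent of representatives and equivariant without any inclusion between the [L l] and the
    [M i]. *)
Definition coset_map (f : permmod k (coset_gset L)) : permmod k (coset_gset M) :=
  [ffun s : coset_gset M => \sum_(g in (val s).2) \sum_l n (val s).1 l * f (coset_pt L l g)].

Lemma coset_mapE f i g : coset_map f (coset_pt M i g) =
  \sum_(h in M i) \sum_l n i l * f (coset_pt L l (g * h)%g).
Proof.
rewrite ffunE /= (reindex_inj (mulgI g)) /=.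
by apply: eq_bigl => h; rewrite mem_lcoset mulKg.
Qed.

Fact coset_map_is_linear : linear coset_map.
Proof.
move=> a u v; apply/ffunP => s; have [i [g ->]] := coset_ptP s.
have permmodE (X : gset gT) (b : galg k gT) (w w' : permmod k X) x :
    (b *: w + w') x = \sum_h b h * w (Defs.gact h^-1%g x) + w' x.
  by rewrite !ffunE.
rewrite permmodE !coset_mapE.
under [in RHS]eq_bigr do rewrite coset_act_pt coset_mapE mulr_sumr.
rewrite [X in _ = X + _]exchange_big -big_split; apply: eq_bigr => m _ /=.
under [in RHS]eq_bigr do rewrite mulr_sumr.
rewrite [X in _ = X + _]exchange_big -big_split; apply: eq_bigr => l _ /=.
rewrite (permmodE (coset_gset L) a u v) mulrDr mulr_sumr; congr (_ + _).
by apply: eq_bigr => h _; rewrite coset_act_pt mulgA mulrCA.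
Qed.

HB.instance Definition _ := GRing.isLinear.Build _ _ _ _ coset_map coset_map_is_linear.

End CosetMap.

Lemma coset_map_bij (k : fieldType) (gT : finGroupType) (I : finType)
    (L M : I -> {group gT}) (n : I -> I -> k) :
  #|coset_gset L| = #|coset_gset M| ->
  (forall f : permmod k (coset_gset L),
     (forall i g, coset_map M n f (coset_pt M i g) = 0) ->
     forall i g, f (coset_pt L i g) = 0) ->
  linearly_equivalent k (coset_gset L) (coset_gset M).
Proof.
move=> eqc inj0; exists (coset_map (L := L) M n).
apply: linear_ffun_inj_bij eqc _ _ => [a u v | u u0].
  apply/ffunP => s; have [i [g ->]] := coset_ptP s.
  rewrite [in RHS]ffunE !coset_mapE mulr_sumr -big_split; apply: eq_bigr => h _ /=.
  rewrite mulr_sumr -big_split; apply: eq_bigr => l _ /=.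
  by rewrite ffunE mulrDr mulrCA.
apply/ffunP => s; have [i [g ->]] := coset_ptP s.
by rewrite inj0 ?ffunE // => j h; rewrite u0 ffunE.
Qed.

(** An element outside <x> has image of order q in F/<x>, so its order is q or pq with p = #[x];
    order pq would make [F] cyclic. *)
Lemma noncyclic_metacyclic_order (rT : finGroupType) (F : {group rT}) x :
  ~~ cyclic F -> (<[x]> <| F)%g -> prime #[x]%g -> prime #|F : <[x]>|%g ->
  exists2 y, y \in F & forall j, #[y * x ^+ j]%g = #|F : <[x]>|%g.
Proof.
move=> ncF nxF pr_x pr_q; have [sxF nFx] := andP nxF.
set q := #|F : _|%g in pr_q *.
have /subsetPn[y Fy nxy] : ~~ (F \subset <[x]>%g).
  by rewrite -indexg_eq1 neq_ltn prime_gt1 ?orbT.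
exists y => // j; set z := (y * x ^+ j)%g.
have Fx : x \in F by rewrite -cycle_subG.
have Fz : z \in F by rewrite groupM ?groupX.
have nxz : z \notin <[x]>%g by rewrite groupMr ?mem_cycle.
have Nz : z \in ('N(<[x]>))%g by apply: (subsetP nFx).
have oz : #[coset <[x]>%g z]%g = q.
  apply/prime_nt_dvdP => //.
    by rewrite order_eq1; apply: contra nxz => /eqP/coset_idr->.
  by rewrite /q -card_quotient // order_dvdG ?mem_quotient.
have q_dv : (q %| #[z]%g)%N by rewrite -oz morph_order.
have [m def_z] := dvdnP q_dv.
have : (#[z]%g %| #|F|)%N by rewrite order_dvdG.
rewrite -(Lagrange sxF) -/q def_z dvdn_pmul2r ?prime_gt0 // -orderE.
have [-> _ | m1 /(prime_nt_dvdP pr_x m1) eq_m] := eqVneq m 1%N; first by rewrite mul1n.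
case/negP: ncF; rewrite (_ : F :=: <[z]>%g) ?cycle_cyclic //.
by apply/esym/eqP; rewrite eqEcard cycle_subG Fz -(Lagrange sxF) -!orderE def_z eq_m /=.
Qed.

(** Each fibre of [coset K] over [A] is a coset of [K]. *)
Lemma sum_cosetpre (gT : finGroupType) (V : nmodType) (K : {group gT})
    (A : {group coset_of K}) (h : coset_of K -> V) :
  \sum_(g in (coset K @*^-1 A)%g) h (coset K g) = (\sum_(u in A) h u) *+ #|K|.
Proof.
rewrite (partition_big (coset K) (mem A)) /= => [|g]; last by case/morphpreP.
rewrite -sumrMnl; apply: eq_bigr => u Au.
rewrite (eq_bigr (fun=> h u)) => [|g /andP[_ /eqP->] //]; rewrite sumr_const.
have [g Ng def_u] := cosetP u.
rewrite -(card_rcoset K g) -val_coset // -def_u; congr (_ *+ _); apply: eq_card => a.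
apply/andP/idP => [[/morphpreP[Na _] /eqP <-]|ua].
  by rewrite /= val_coset // rcoset_refl.
have eu := coset_mem ua; split; last exact/eqP.
apply/morphpreP; split; last by rewrite /= eu.
move: ua; rewrite def_u /= val_coset //.
by case/rcosetP=> b Kb ->; rewrite groupM // (subsetP (normG K)).
Qed.

(** An isomorphism would send the base point of G/L_i to a point whose stabilizer, a conjugate of
    some M_j, fixes that base point and so lies in L_i. *)
Lemma coset_gset_not_iso (gT : finGroupType) (I : finType) (L M : I -> {group gT}) i :
  (forall j, (#|L i| < #|M j|)%N) -> ~ gset_iso (coset_gset L) (coset_gset M).
Proof.
move=> ltLM [phi bij_phi phiJ].
have [j [g def_phi]] := coset_ptP (phi (coset_pt L i 1%g)).
suff /subset_leq_card : (M j :^ g^-1)%g \subset L i by rewrite cardJg leqNgt ltLM.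
apply/subsetP => h; rewrite mem_conjg invgK => Mh.
rewrite -[h]conjg1; apply: coset_stab; apply: (bij_inj bij_phi).
rewrite phiJ def_phi coset_act_pt.
rewrite -[(h * g)%g](_ : (g * h ^ g) = _)%g; first exact: coset_ptMr.
by rewrite -conjgC.
Qed.

Lemma sum_option (V : nmodType) (T : finType) (h : option T -> V) :
  \sum_i h i = h None + \sum_j h (Some j).
Proof.
rewrite (bigD1 None) //=; congr (_ + _).
rewrite (reindex_omap Some id) /=; first by apply: eq_bigl => j; rewrite eqxx.
by case.
Qed.

(** * The two linearly equivalent G-sets *)

Section Relation.
Variables (gT : finGroupType) (H K : {group gT}) (x y : coset_of K) (q : nat).
Hypotheses (nKH : (K <| H)%g) (nx : (<[x]> <| H / K)%g) (Fy : y \in (H / K)%g).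
Hypotheses (pr_x : prime #[x]%g) (pr_q : prime q).
Hypotheses (ix : #|(H / K)%g : <[x]>|%g = q) (oyx : forall j, #[y * x ^+ j]%g = q).

(** Inducing H/A to G gives G/A, so the induced sets are unions of coset spaces of G: here [None]
    stands for G/K and each [Some j] for a copy of G/H. *)
Definition source_groups (i : option 'I_q) : {group gT} := if i is Some _ then H else K.

Definition target_quotients (i : option 'I_q) : {group coset_of K} :=
  (if i is Some j then <[y * x ^+ (j : nat)]> else <[x]>)%G.

Definition target_groups i : {group gT} := (coset K @*^-1 target_quotients i)%G.

Let X := coset_gset source_groups.
Let Y := coset_gset target_groups.

Let Fx : x \in (H / K)%g.
Proof. by rewrite -cycle_subG normal_sub. Qed.

Lemma card_target_groups i :
  #|target_groups i| = (#|K| * if i is Some _ then q else #[x]%g)%N.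
Proof.
rewrite /target_groups /= card_morphpre ?ker_coset; last first.
  by rewrite im_coset subsetT.
by case: i => [j|]; rewrite -orderE ?oyx.
Qed.

Let card_H : #|H| = (#|K| * (#[x]%g * q))%N.
Proof.
rewrite -(Lagrange (normal_sub nKH)) -card_quotient ?normal_norm // -ix.
by rewrite orderE Lagrange ?normal_sub.
Qed.

Let index_mul (A : {group gT}) m :
  #|A| = (#|K| * m)%N -> (#|[set: gT] : A|%g * m)%N = #|[set: gT] : K|%g.
Proof.
move=> cA; apply/eqP; rewrite -(eqn_pmul2l (cardG_gt0 K)) (Lagrange (subsetT K)).
by rewrite mulnCA -cA mulnC (Lagrange (subsetT A)).
Qed.

(** This is |G : K| + q |G : H| with |H : K| = pq, cleared of the denominator p = #[x]. *)
Lemma card_source : (#|X| * #[x]%g = #|[set: gT] : K|%g * (#[x]%g).+1)%N.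
Proof.
rewrite card_coset_gset sum_option /= sum_nat_const card_ord mulnDl.
rewrite mulnS addnC; congr (_ + _)%N.
by rewrite -(index_mul card_H) mulnAC mulnC (mulnC q).
Qed.

Lemma card_source_target : #|X| = #|Y|.
Proof.
apply/eqP; rewrite -(eqn_pmul2r (order_gt0 x)) card_source; apply/eqP.
rewrite card_coset_gset sum_option mulnDl (index_mul (card_target_groups None)).
rewrite mulnS; congr (_ + (_ * _))%N.
apply/eqP; rewrite -(eqn_pmul2r (prime_gt0 pr_q)) big_distrl /=.
under eq_bigr => j _ do rewrite (index_mul (card_target_groups (Some j))).
by rewrite sum_nat_const card_ord mulnC.
Qed.

Let target_sub i : target_groups i \subset H.
Proof.
rewrite -(quotientGK nKH) morphpreS //.
by case: i => [j|] /=; rewrite cycle_subG // groupM ?groupX.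
Qed.

Let coset_pt_repr g z : z \in ('N(K))%g ->
  coset_pt source_groups None (g * repr (coset K z))%g = coset_pt source_groups None (g * z)%g.
Proof.
move=> Nz; have /rcosetP[b Kb ->] : repr (coset K z) \in (K :* z)%g.
  by rewrite -val_coset // mem_repr_coset.
by rewrite (conjgC b) mulgA; apply: coset_ptMr; rewrite /= memJ_norm.
Qed.

Lemma source_target_equiv : linearly_equivalent rat X Y.
Proof.
(* Every target orbit sums the function on G/K; the orbit [Some j] also adds the function on the
   j-th copy of G/H. *)
pose n (i l : option 'I_q) : rat := ((l == None) || (l == i))%:R.
apply: (coset_map_bij (n := n) card_source_target) => f f0.
have [sKH nK] := andP nKH.
(* For fixed g, [phi g] is the restriction of f to the translate by g of H/K in G/K, and [d g]
   records the constants of f on the points gH. *)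
pose phi g (u : coset_of K) : rat := f (coset_pt source_groups None (g * repr u)%g).
pose d g i : rat := if i is Some _ then f (coset_pt source_groups i g) else 0.
have key g v i : v \in (H / K)%g ->
  \sum_(u in target_quotients i) (phi g (v * u)%g + d g i) = 0.
  case/morphimP=> v0 Nv0 Hv0 ->; have := f0 i (g * v0)%g.
  rewrite coset_mapE.
  rewrite (eq_bigr (fun h => phi g (coset K v0 * coset K h)%g + d g i)); last first.
    move=> h /(subsetP (target_sub i)) Hh.
    have Nh := subsetP nK h Hh.
    rewrite /phi -morphM // coset_pt_repr ?groupM // sum_option /n /= mul1r -mulgA.
    congr (_ + _); case: i {f0} => [j|]; last by rewrite big1 // => j _; rewrite mul0r.
    rewrite (bigD1 j) //= eqxx mul1r big1 ?addr0 => [|l /negPf neq_lj].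
      by rewrite coset_ptMr //= groupM.
    by rewrite -[_ == _]/(l == j) neq_lj mul0r.
  (* The sum descends to H/K at the cost of a factor |K|, which is invertible in the rationals. *)
  rewrite (sum_cosetpre (target_quotients i) (fun u => phi g (coset K v0 * u)%g + d g i)).
  by move/eqP; rewrite mulrn_eq0 -[_ == 0%N]negbK -lt0n cardG_gt0 => /eqP.
have sums g : (forall v, v \in (H / K)%g -> ratr (phi g v) = 0 :> algC) /\
    (forall j : 'I_q, ratr (d g (Some j)) = 0 :> algC).
  (* The constant is summed over the q elements of <y x^j>, whence the factor q; 0 is the default
     for j >= q. *)
  pose c j : algC := q%:R * oapp (fun i => ratr (d g (Some i))) 0 (insub j).
  have [|v Fv|v Fv j lt_j|phi0 c0] := @section_sums_eq0 _ x y q pr_x pr_q _ oyx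
      (H / K)%G (fun u => ratr (phi g u)) c Fx Fy.
  - by rewrite (subsetP (normal_norm nx)).
  - have := key g v None Fv; rewrite /= big_split /= sumr_const mul0rn addr0.
    by move/(congr1 (@ratr algC)); rewrite rmorph_sum rmorph0.
  - have := key g v (Some (Ordinal lt_j)) Fv.
    rewrite /= big_split /= sumr_const -orderE oyx => /(congr1 (@ratr algC)).
    by rewrite rmorphD rmorph_sum rmorph0 rmorphMn /c insubT /= mulr_natl.
  split=> // j; have := c0 j (ltn_ord j); rewrite /c valK /= => /eqP.
  by rewrite mulf_eq0 pnatr_eq0 -[_ == 0%N]negbK -lt0n prime_gt0 //= => /eqP.
move=> [j|] g; have [phi0 d0] := sums g.
  by apply/eqP; rewrite -(fmorph_eq0 (@ratr algC)); apply/eqP; exact: (d0 j).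
apply/eqP; rewrite -(fmorph_eq0 (@ratr algC)); apply/eqP.
by have := phi0 1%g (group1 _); rewrite /phi repr_coset1 mulg1.
Qed.

Lemma source_target_md_witness : md_witness rat gT #|X|.
Proof.
exists X, Y; split=> //; first by rewrite card_source_target.
  apply: (coset_gset_not_iso (i := None)) => j; rewrite card_target_groups /=.
  by rewrite -[leqLHS]muln1 ltn_pmul2l ?cardG_gt0 //; case: j => [_|]; exact: prime_gt1.
exact: source_target_equiv.
Qed.
End Relation.

(** * The bound 3/2 *)

Lemma md_le_witness (k : comPzRingType) (gT : finGroupType) m :
  md_witness k gT m -> (md k gT <= (m%:R)%:E)%E.
Proof.
move=> wm; rewrite /md; case: pselect => [ex | []]; last by exists m; apply/asboolP.
rewrite lee_fin ler_nat; case: ex_minnP => m0 _; apply; exact/asboolP.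
Qed.

Theorem theorem3p1 (gT : finGroupType) (ncG : ~~ cyclic [set: gT]) :
  (md rat gT / (#|gT|%:R)%:E <= (3 / 2)%R%:E)%E.
Proof.
have [H [K [nKH ncHK [x _ [nx pr_x pr_q]]]]] := noncyclic_metacyclic_section ncG.
have [y Fy oyx] := noncyclic_metacyclic_order ncHK nx pr_x pr_q.
have cardX := card_source nKH nx (erefl _).
have := md_le_witness (source_target_md_witness nKH nx Fy pr_x pr_q (erefl _) oyx).
set m := #|_| in cardX *; move=> le_md.
(* With p = #[x] >= 2, m = |G : K| (1 + 1/p) is at most 3/2 |G : K|. *)
have le_m : (2 * m <= 3 * #|gT|)%N.
  rewrite -(leq_pmul2r (order_gt0 x)) -mulnA cardX.
  apply: (@leq_trans (3 * #|[set: gT] : K|%g * #[x]%g)%N); last first.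
    by rewrite leq_mul2r leq_mul2l -cardsT dvdn_leq ?cardG_gt0 ?dvdn_indexg ?orbT.
  rewrite mulnCA -mulnA [leqRHS]mulnCA leq_mul2l mulnS [leqRHS]mulSn leq_add2r.
  by rewrite prime_gt1 ?orbT.
have gT_gt0 : 0 < #|gT|%:R :> rat by rewrite ltr0n -cardsT cardG_gt0.
rewrite inver gt_eqF // lee_pdivrMr //; apply: le_trans le_md _.
rewrite -EFinM lee_fin mulrAC ler_pdivlMr // mulrC -!natrM ler_nat.
exact: le_m.
Qed.
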